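(* In SVRG-I, if $m$ and $\eta$ are chosen such that $$\alpha:=\left(1-2\eta\mu(1-\eta L)\right)^m+\frac{4\eta L^2}{\mu(1-\eta L)}<1,$$ then SVRG-I converges linearly in expectation: $$\mathbb{E}\left\|\tilde{x}_{k}-x^*\right\|_2^2<\alpha^k\,\|\tilde{x}_0-x^*\|_2^2 .$$
   Context: Setting. Consider the problem of minimizing $F(x)=\frac1n\sum_{i=1}^n f_i(x)$ over $x\in\mathbb{R}^d$, with optimal solution $x^*$. Each $f_i:\mathbb{R}^d\to\mathbb{R}$ is convex and differentiable with $L$-Lipschitz continuous gradient, i.e. $\|\nabla f_i(x)-\nabla f_i(y)\|_2\le L\|x-y\|_2$ for all $x,y\in\mathbb{R}^d$, and $F$ is $\mu$-strongly convex ($\mu>0$), i.e. $F(y)\ge F(x)+\nabla F(x)^\top(y-x)+\frac{\mu}{2}\|x-y\|_2^2$ for all $x,y\in\mathbb{R}^d$. Algorithm SVRG-I (stochastic variance reduced gradient method with Option I, meaning that the last inner iterate is used as the next outer iterate). Parameters: update frequency $m$, step size $\eta>0$, initial point $\tilde{x}_0$. For $k=0,1,\dots$ (the $k$-th epoch): set $g_k=\frac1n\sum_{i=1}^n\nabla f_i(\tilde{x}_k)$ and $x_0=\tilde{x}_k$; for $t=0,\dots,m-1$, randomly pick $i_t\in\{1,\dots,n\}$ and set $$x_{t+1}=x_t-\eta\bigl(\nabla f_{i_t}(x_t)-\nabla f_{i_t}(\tilde{x}_k)+g_k\bigr);$$ finally set $\tilde{x}_{k+1}=x_m$. It is assumed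 that the stochastic gradients are unbiased: $\mathbb{E}[\nabla f_{i_t}(x_t)\mid x_t]=\nabla F(x_t)$ for any $x_t$. The expectation $\mathbb{E}$ is with respect to the random choices of the indices $i_t$.
   Formalization: The conditions ηL < 1, k ≥ 1 and x̃_0 ≠ x* are added: for ηL > 1, α can be negative and the bound fails (f = x²/2, L = μ = m = 1, η = 3/2), and for k = 0 or x̃_0 = x* both sides are equal, so the strict inequality fails. *)

(* Defs.v *)
From HB Require Import structures.
From mathcomp Require Import all_boot all_order all_algebra.
From mathcomp Require Import all_classical all_reals all_analysis.

Set Implicit Arguments.
Unset Strict Implicit.
Unset Printing Implicit Defensive.

Import Order.TTheory GRing.Theory Num.Theory.
Import numFieldNormedType.Exports.

Local Open Scope classical_set_scope.
Local Open Scope ring_scope.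

(* R^d is 'rV[R]_d. The library norm `|x| on matrices is the sup norm, hence
   the explicit Euclidean structure. *)
Definition dotv (R : realType) (d : nat) (u v : 'rV[R]_d) : R :=
  \sum_(j < d) u 0 j * v 0 j.

Definition norm2 (R : realType) (d : nat) (u : 'rV[R]_d) : R :=
  Num.sqrt (dotv u u).

(* The vector of partial derivatives. It is the gradient only where f is
   differentiable, since 'D_v is a default value elsewhere. *)
Definition grad (R : realType) (d : nat) (f : 'rV[R]_d -> R) (x : 'rV[R]_d) :
    'rV[R]_d :=
  \row_(j < d) 'D_(delta_mx 0 j) f x.

Definition lipschitz_grad (R : realType) (d : nat) (L : R)
    (f : 'rV[R]_d -> R) : Prop :=
  forall x y, norm2 (grad f x - grad f y) <= L * norm2 (x - y).

Definition strongly_convex (R : realType) (d : nat) (mu : R)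
    (F : 'rV[R]_d -> R) : Prop :=
  forall x y,
    F x + dotv (grad F x) (y - x) + mu / 2 * norm2 (x - y) ^+ 2 <= F y.

Definition avg (R : realType) (d n : nat) (f : 'I_n -> 'rV[R]_d -> R)
    (x : 'rV[R]_d) : R :=
  n%:R^-1 * \sum_(i < n) f i x.

Section svrg.
Variables (R : realType) (d n : nat) (f : 'I_n -> 'rV[R]_d -> R).
Variables (m : nat) (eta : R).

Definition full_grad (x : 'rV[R]_d) : 'rV[R]_d :=
  n%:R^-1 *: \sum_(i < n) grad (f i) x.

(* x_t within an epoch started at xk; pick t is the index used to pass from
   x_t to x_(t+1). *)
Fixpoint svrg_inner (xk : 'rV[R]_d) (pick : nat -> 'I_n) (t : nat) :
    'rV[R]_d :=
  if t is t'.+1 then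
    let x := svrg_inner xk pick t' in
    x - eta *: (grad (f (pick t')) x - grad (f (pick t')) xk + full_grad xk)
  else xk.

(* The draws of all epochs are numbered consecutively: inner step t of epoch k
   uses draw number k * m + t. *)
Fixpoint svrgI (x0 : 'rV[R]_d) (pick : nat -> 'I_n) (k : nat) : 'rV[R]_d :=
  if k is k'.+1 then
    svrg_inner (svrgI x0 pick k') (fun t => pick (k' * m + t)%N) m
  else x0.

End svrg.

Section sampling.
Variables (R : realType) (d n : nat).
Variables (disp : measure_display) (T : measurableType disp).
Variables (P : probability T R) (idx : nat -> T -> 'I_n).

Definition random_indices : Prop :=
  forall s i, measurable [set w | idx s w = i].

(* The event that draws 0, ..., s-1 take the values h 0, ..., h (s-1). These
   events are the atoms of the sigma-algebra generated by the first s draws. *)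
Definition past (s : nat) (h : nat -> 'I_n) : set T :=
  [set w | forall r, (r < s)%N -> idx r w = h r].

(* E[ grad f_(i_s) (x) | draws before s ] = grad F (x) for every point x,
   written coordinatewise as E[Y 1_H] = c P(H) on each atom H of the past.
   On such an atom the current iterates are determined, so x may in particular
   be the current x_t. Independent uniform draws satisfy this. *)
Definition unbiased (f : 'I_n -> 'rV[R]_d -> R) : Prop :=
  forall (s : nat) (h : nat -> 'I_n) (x : 'rV[R]_d) (j : 'I_d),
    ('E_P[fun w => (grad (f (idx s w)) x 0 j * \1_(past s h) w)%R]
     = (grad (avg f) x 0%R j)%:E * P (past s h))%E.

End sampling.

Definition svrg_rate (R : realType) (mu L eta : R) (m : nat) : R :=
  (1 - 2 * eta * mu * (1 - eta * L)) ^+ m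
  + 4 * eta * L ^+ 2 / (mu * (1 - eta * L)).

(* Main.v *)
(* With D the squared distance to x*, g the gradient of F, b the gradient of
   f_i at x* and e = x_t - x*, expand D(x_(t+1)) and split the search direction
   v as (grad f_i(x_t) - b) - (grad f_i(xk) - b - g(xk)). Cocoercivity of
   grad f_i bounds the square of the first part by L <grad f_i(x_t) - b, e>,
   Lipschitz continuity bounds that of the second by 4 L^2 D(xk); hence
   |v|^2 <= 2 L <grad f_i(x_t) - b, e> + 8 L^2 D(xk). Unbiasedness is used only
   through its consequence that grad f_i - g, evaluated at x_t, xk or x* and
   paired with e, has expectation zero, and <g(x_t), e> >= mu D(x_t) then gives
   E D(x_(t+1)) <= rho E D(x_t) + 8 eta^2 L^2 E D(xk)
   with rho = 1 - 2 eta mu (1 - eta L) in (0, 1), because mu <= L.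
   Since finitely many draws are involved, the expectations are finite sums
   over the histories of draws. *)
Require Import Defs.
From HB Require Import structures.
From mathcomp Require Import all_boot all_order all_algebra.
From mathcomp Require Import all_classical all_reals all_analysis.
From mathcomp Require Import ring lra.

Set Implicit Arguments.
Unset Strict Implicit.
Unset Printing Implicit Defensive.

Import Order.TTheory GRing.Theory Num.Theory.
Import numFieldNormedType.Exports.

Local Open Scope classical_set_scope.
Local Open Scope ring_scope.

(** * Euclidean inner product on row vectors *)

Section euclidean.
Variables (R : realType) (d : nat).
Implicit Types u v w : 'rV[R]_d.

Lemma dotvC u v : dotv u v = dotv v u.
Proof. by apply: eq_bigr => j _; rewrite mulrC. Qed.

Lemma dotvDl u v w : dotv (u + v) w = dotv u w + dotv v w.
Proof. by rewrite -big_split; apply: eq_bigr => j _; rewrite mxE mulrDl. Qed.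

Lemma dotvZl a u w : dotv (a *: u) w = a * dotv u w.
Proof. by rewrite mulr_sumr; apply: eq_bigr => j _; rewrite mxE mulrA. Qed.

Lemma dotvNl u w : dotv (- u) w = - dotv u w.
Proof. by rewrite -scaleN1r dotvZl mulN1r. Qed.

Lemma dotvBl u v w : dotv (u - v) w = dotv u w - dotv v w.
Proof. by rewrite dotvDl dotvNl. Qed.

Lemma dotvDr u v w : dotv w (u + v) = dotv w u + dotv w v.
Proof. by rewrite dotvC dotvDl !(dotvC w). Qed.

Lemma dotvZr a u w : dotv w (a *: u) = a * dotv w u.
Proof. by rewrite dotvC dotvZl (dotvC w). Qed.

Lemma dotvNr u w : dotv w (- u) = - dotv w u.
Proof. by rewrite dotvC dotvNl (dotvC w). Qed.

Lemma dotv0l u : dotv 0 u = 0.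
Proof. by rewrite -(scale0r 0) dotvZl mul0r. Qed.

Lemma dotv_suml (I : finType) (F : I -> 'rV[R]_d) w :
  dotv (\sum_i F i) w = \sum_i dotv (F i) w.
Proof.
elim/big_rec2: _ => [|i u x _ <-]; first exact: dotv0l.
by rewrite dotvDl.
Qed.

Definition dotvE := (dotvDl, dotvDr, dotvNl, dotvNr, dotvZl, dotvZr).

Lemma dotvv_ge0 u : 0 <= dotv u u.
Proof. by apply: sumr_ge0 => j _; rewrite -expr2 sqr_ge0. Qed.

Lemma dotvv_eq0 u : dotv u u = 0 -> u = 0.
Proof.
move=> /eqP; rewrite psumr_eq0; last by move=> j _; rewrite -expr2 sqr_ge0.
move=> /allP u0; apply/rowP => j; rewrite mxE; apply/eqP.
by have := u0 j (mem_index_enum _); rewrite -expr2 sqrf_eq0.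
Qed.

Lemma norm2_sqr u : norm2 u ^+ 2 = dotv u u.
Proof. by rewrite sqr_sqrtr ?dotvv_ge0. Qed.

Lemma norm2_ge0 u : 0 <= norm2 u.
Proof. exact: sqrtr_ge0. Qed.

(** Cauchy-Schwarz without square roots: for [c > 0] expand [|u - c v|^2 >= 0]; for [c = 0] the
    hypothesis forces [u = 0]. *)
Lemma dotv_le c u v : 0 <= c -> dotv u u <= c ^+ 2 * dotv v v ->
  dotv u v <= c * dotv v v.
Proof.
rewrite le_eqVlt => /orP[/eqP <-|c0 uv].
  rewrite expr2 !mul0r => u0; have /dotvv_eq0 -> : dotv u u = 0.
    by apply/eqP; rewrite eq_le u0 dotvv_ge0.
  by rewrite dotv0l.
have := dotvv_ge0 (u - c *: v); rewrite !dotvE (dotvC v u) => h.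
rewrite -(ler_pM2l c0); nra.
Qed.

Lemma dotv_sqrB_le u v :
  dotv (u - v) (u - v) <= 2 * dotv u u + 2 * dotv v v.
Proof.
by have := dotvv_ge0 (u + v); rewrite !dotvE (dotvC v u); lra.
Qed.

End euclidean.

(** * Gradient inequalities for smooth and convex functions *)

Section smooth.
Variables (R : realType) (d : nat) (f : 'rV[R]_d -> R).
Hypothesis f_diff : forall x, differentiable f x.
Implicit Types x y v : 'rV[R]_d.

Lemma derive_grad x v : 'D_v f x = dotv (grad f x) v.
Proof.
rewrite deriveE// [in LHS](row_sum_delta v) linear_sum.
apply: eq_bigr => j _; rewrite linearZ/= mxE deriveE//.
by rewrite mulrC.
Qed.

Lemma is_derive_line x v (t : R) :
  is_derive t 1 (fun s => f (x + s *: v)) (dotv (grad f (x + t *: v)) v).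
Proof.
have E : (fun h : R => h^-1 *: (((fun s => f (x + s *: v)) \o shift t) (h *: 1)
    - f (x + t *: v))) =
  (fun h : R => h^-1 *: ((f \o shift (x + t *: v)) (h *: v) - f (x + t *: v))).
  apply/funext => h /=; congr (_ *: (f _ - _)).
  by rewrite scalerDl addrCA [h *: 1]mulr1.
have dv : derivable f (x + t *: v) v by exact: diff_derivable.
split; first by rewrite /derivable E.
by rewrite -derive_grad /derive E.
Qed.

Variable L : R.
Hypothesis f_lip : lipschitz_grad L f.

Lemma lipschitz_grad_sqr (L_ge0 : 0 <= L) x y :
  dotv (grad f x - grad f y) (grad f x - grad f y)
    <= L ^+ 2 * dotv (x - y) (x - y).
Proof.
rewrite -!norm2_sqr -exprMn lerXn2r ?nnegrE ?norm2_ge0//.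
by rewrite mulr_ge0 ?norm2_ge0.
Qed.

(** The sign [s], which is 1 or -1, yields the quadratic majorant and minorant in one proof. Along
    the segment [g] has nonpositive derivative, so the mean value theorem gives [g 1 <= g 0]. *)
Lemma taylor_le (L_ge0 : 0 <= L) (s : R) x v : s ^+ 2 = 1 ->
  s * (f (x + v) - f x - dotv (grad f x) v) <= L / 2 * dotv v v.
Proof.
move=> s1.
pose g (t : R) : R := s * (f (x + t *: v) - t * dotv (grad f x) v)
  - L / 2 * dotv v v * t ^+ 2.
pose dg (t : R) : R := s * (dotv (grad f (x + t *: v)) v - dotv (grad f x) v)
  - L / 2 * dotv v v * (2 * t).
have dgP (t : R) : is_derive t (1 : R) g (dg t).
  have ? := is_derive_line x v t.
  rewrite /g; apply: is_derive_eq.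
  rewrite /dg /GRing.scale/=; ring.
have [|t t01] := @MVT R g dg 0 1 ltr01 (fun t _ => dgP t).
  apply: derivable_within_continuous => t _.
  exact: ex_derive.
rewrite /g subr0 mulr1 scale1r scale0r addr0 mul1r mul0r subr0.
rewrite expr1n expr0n/= mulr0 subr0 mulr1 => gE.
have t0 : 0 < t by move: t01; rewrite in_itv/= => /andP[].
suff : dg t <= 0 by nra.
have : s * (dotv (grad f (x + t *: v)) v - dotv (grad f x) v)
    <= L * t * dotv v v.
  rewrite -dotvBl -dotvZl; apply: dotv_le; first by rewrite mulr_ge0// ltW.
  rewrite dotvZl dotvZr mulrA -expr2 s1 mul1r.
  have := lipschitz_grad_sqr L_ge0 (x + t *: v) x.
  by rewrite [x + _]addrC addrK dotvZl dotvZr; lra.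
rewrite /dg; lra.
Qed.

Hypothesis f_convex : convex_function [set: 'rV[R]_d] f.

(** Convexity on the segment is compared with the quadratic minorant at [x] in the point
    [x + t (y - x)]; after division by [t] the error is at most the arbitrary [e > 0]. *)
Lemma convex_grad_le (L_ge0 : 0 <= L) x y :
  f x + dotv (grad f x) (y - x) <= f y.
Proof.
rewrite -lerBrDl; apply/ler_addgt0Pr => e e0.
(* The added 1 keeps [K] positive even if [x = y], so the [t] below satisfies [0 < t <= 1] and
   [t * K <= e]. *)
pose K := L / 2 * dotv (y - x) (y - x) + 1.
have K0 : 0 < K by rewrite ltr_wpDl// !mulr_ge0// ?dotvv_ge0 ?invr_ge0.
pose t := Num.min 1 (e / K).
have t0 : 0 < t by rewrite lt_min ltr01 divr_gt0.
have t1 : t <= 1 by rewrite ge_min lexx.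
have tK : t * K <= e by rewrite -ler_pdivlMr// ge_min lexx orbT.
pose t01 := Itv01 (ltW t0) t1.
have := f_convex t01 (mem_set I : y \in setT) (mem_set I : x \in setT).
rewrite convRE/=.
have -> : conv t01 (y : convex_lmodType _) (x : convex_lmodType _) =
    x + t *: (y - x).
  rewrite /conv/= /unstable.onem scalerBl scale1r scalerBr addrC -!addrA.
  by congr (_ + _); rewrite addrC.
have := @taylor_le L_ge0 (-1) x (t *: (y - x)).
rewrite sqrrN expr1n dotvZr dotvZl dotvZr /unstable.onem => /(_ erefl) h1 h2.
rewrite -(ler_pM2l t0).
rewrite /K in tK; set D := dotv (y - x) (y - x) in h1 tK *.
set G := dotv _ _ in h1 *.
nra.
Qed.

(* Compare [f] with its linear minorant at [x] in the point
   [y - (grad f y - grad f x) / L], and with its quadratic majorant at [y]. *)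
Lemma grad_gap_le (L_gt0 : 0 < L) x y :
  dotv (grad f y - grad f x) (grad f y - grad f x) / (2 * L)
    <= f y - f x - dotv (grad f x) (y - x).
Proof.
set g := grad f y - grad f x.
have := convex_grad_le (ltW L_gt0) x (y - L^-1 *: g).
have := @taylor_le (ltW L_gt0) 1 y (- (L^-1 *: g)) (expr1n _ _).
have -> : y - L^-1 *: g - x = (y - x) - L^-1 *: g by rewrite addrAC.
rewrite (dotvDr (y - x)) !dotvNr dotvNl !dotvZr dotvZl.
have -> : dotv (grad f y) g = dotv g g + dotv (grad f x) g.
  by rewrite -dotvDl subrK.
have -> : L / 2 * - - (L^-1 * (L^-1 * dotv g g)) = L^-1 * dotv g g / 2.
  by field; rewrite gt_eqF.
have -> : dotv g g / (2 * L) = L^-1 * dotv g g / 2.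
  by field; rewrite gt_eqF.
lra.
Qed.

(** Baillon-Haddad: in the sum of [grad_gap_le] for both orders of the points the function values
    cancel. *)
Lemma cocoercive (L_gt0 : 0 < L) x y :
  dotv (grad f x - grad f y) (grad f x - grad f y)
    <= L * dotv (grad f x - grad f y) (x - y).
Proof.
have := grad_gap_le L_gt0 x y; have := grad_gap_le L_gt0 y x.
rewrite -(opprB (grad f x)) -(opprB x) dotvNl !dotvNr opprK !dotvBl -!dotvBl.
set G := dotv (grad f x - grad f y) (grad f x - grad f y).
move=> h1 h2.
have : G / (2 * L) + G / (2 * L) <= dotv (grad f x - grad f y) (x - y).
  rewrite dotvBl; lra.
have -> : G / (2 * L) + G / (2 * L) = G / L by field; rewrite gt_eqF.
by rewrite ler_pdivrMr// mulrC.
Qed.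

End smooth.

(** * The average of the components *)

Section average.
Variables (R : realType) (d n : nat) (f : 'I_n -> 'rV[R]_d -> R).
Hypothesis f_diff : forall i x, differentiable (f i) x.

Lemma avgE : avg f = n%:R^-1 \*: \sum_(i < n) f i.
Proof. by apply/funext => x; rewrite /avg /= fct_sumE. Qed.

Lemma differentiable_avg x : differentiable (avg f) x.
Proof.
rewrite avgE; apply: differentiableZ.
by apply: differentiable_sum => i.
Qed.

Lemma grad_avg x : grad (avg f) x = full_grad f x.
Proof.
apply/rowP => j; rewrite avgE !mxE.
have df i : derivable (f i) x (delta_mx 0 j) by exact: diff_derivable.
rewrite deriveZ; last exact: derivable_sum.
rewrite derive_sum// summxE; congr (_ * _).
by apply: eq_bigr => i _; rewrite mxE.
Qed.

(** With [u_i] the gradient difference of [f i], [2 |g|^2] is the mean of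
    [2 <u_i, g> <= |u_i|^2 + |g|^2]; this replaces the triangle inequality. *)
Lemma lipschitz_grad_avg L : 0 <= L -> (forall i, lipschitz_grad L (f i)) ->
  lipschitz_grad L (avg f).
Proof.
move=> L0 f_lip x y; set g := grad (avg f) x - grad (avg f) y.
have gE : g = n%:R^-1 *: \sum_(i < n) (grad (f i) x - grad (f i) y).
  by rewrite /g !grad_avg /full_grad -scalerBr sumrB.
move: g gE => g gE; have [n0|n_gt0] := posnP n.
  (* The inverse of 0 is 0, so [g] vanishes when [n = 0]. *)
  have nR : n%:R = 0 :> R by rewrite n0.
  move: gE; rewrite nR invr0 scale0r => ->.
  by rewrite {1}/norm2 dotv0l sqrtr0 mulr_ge0 ?norm2_ge0.
have nR : 0 < n%:R :> R by rewrite ltr0n.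
rewrite -ler_sqr ?nnegrE ?mulr_ge0 ?norm2_ge0// exprMn !norm2_sqr.
set D := dotv (x - y) (x - y).
have : 2 * dotv g g <= n%:R^-1 * \sum_(i < n) (L ^+ 2 * D + dotv g g).
  rewrite {1}gE dotvZl dotv_suml mulrCA ler_pM2l ?invr_gt0// mulr_sumr.
  apply: ler_sum => i _.
  have := lipschitz_grad_sqr (f_lip i) L0 x y; rewrite -/D.
  have := dotvv_ge0 ((grad (f i) x - grad (f i) y) - g).
  move: (grad (f i) x - grad (f i) y) => u.
  by rewrite !dotvE (dotvC g u); lra.
rewrite sumr_const card_ord -[(_ + _) *+ n]mulr_natl mulrA.
by rewrite mulVf ?gt_eqF// mul1r; lra.
Qed.

End average.

(** * Strong convexity and minimizers *)

Section strong_convexity.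
Variables (R : realType) (d : nat) (F : 'rV[R]_d -> R) (L mu : R).
Hypothesis F_diff : forall x, differentiable F x.
Hypothesis F_lip : lipschitz_grad L F.
Hypothesis F_sconvex : strongly_convex mu F.

Lemma strongly_monotone x y :
  mu * dotv (x - y) (x - y) <= dotv (grad F x - grad F y) (x - y).
Proof.
have := F_sconvex x y; have := F_sconvex y x.
rewrite !norm2_sqr -(opprB x y) !(dotvNl, dotvNr) !opprK.
rewrite (dotvBl (grad F x)); lra.
Qed.

(** The pairing of [grad F x - grad F y] with [x - y] lies between [mu |x - y|^2] and
    [L |x - y|^2]. *)
Lemma strong_convexity_le_lipschitz (x y : 'rV[R]_d) :
  0 <= L -> x <> y -> mu <= L.
Proof.
move=> L0 xy.
have D0 : 0 < dotv (x - y) (x - y).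
  rewrite lt_neqAle dotvv_ge0 andbT eq_sym; apply/eqP => /dotvv_eq0 /eqP.
  by rewrite subr_eq0 => /eqP.
rewrite -(ler_pM2r D0); apply: le_trans (strongly_monotone x y) _.
exact/dotv_le/lipschitz_grad_sqr.
Qed.

(** A gradient step with step size [1 / L] lowers [F] by at least [|grad F x|^2 / (2 L)], which
    minimality allows only for a zero gradient. *)
Lemma grad_min x : 0 < L -> (forall y, F x <= F y) -> grad F x = 0.
Proof.
move=> L0 xmin; apply: dotvv_eq0; apply/eqP; rewrite eq_le dotvv_ge0 andbT.
have := taylor_le F_diff F_lip (ltW L0) x (- (L^-1 *: grad F x)) (expr1n _ 2).
have := xmin (x - L^-1 *: grad F x).
rewrite !dotvE; set G := dotv _ _.
have -> : L / 2 * - - (L^-1 * (L^-1 * G)) = L^-1 * G / 2.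
  by field; rewrite gt_eqF.
move=> h1 h2; have : L^-1 * G <= 0 by lra.
by rewrite pmulr_rle0 ?invr_gt0.
Qed.

End strong_convexity.

(** * One-step bound for a fixed index *)

Definition noise (R : realType) (d n : nat) (f : 'I_n -> 'rV[R]_d -> R)
  (i : 'I_n) (x : 'rV[R]_d) : 'rV[R]_d := grad (f i) x - grad (avg f) x.

Section contraction.
Variables (R : realType) (d n : nat) (f : 'I_n -> 'rV[R]_d -> R) (L mu eta : R).
Hypothesis f_convex : forall i, convex_function [set: 'rV[R]_d] (f i).
Hypothesis f_diff : forall i x, differentiable (f i) x.
Hypothesis f_lip : forall i, lipschitz_grad L (f i).
Hypothesis L_gt0 : 0 < L.
Hypothesis F_sconvex : strongly_convex mu (avg f).
Variable xs : 'rV[R]_d.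
Hypothesis xs_opt : forall x, avg f xs <= avg f x.
Hypothesis eta_gt0 : 0 < eta.
Hypothesis etaL_lt1 : eta * L < 1.

Let sqdist (x : 'rV[R]_d) : R := dotv (x - xs) (x - xs).
Let rho : R := 1 - 2 * eta * mu * (1 - eta * L).
Let drift : R := 8 * eta ^+ 2 * L ^+ 2.

(* The three [noise] terms have zero conditional mean. *)
Lemma svrg_step_le i x y :
  sqdist (x - eta *: (grad (f i) x - grad (f i) y + full_grad f y)) <=
  rho * sqdist x + drift * sqdist y
  + (2 * eta ^+ 2 * L - 2 * eta) * dotv (noise f i x) (x - xs)
  + 2 * eta * dotv (noise f i y) (x - xs)
  - 2 * eta ^+ 2 * L * dotv (noise f i xs) (x - xs).
Proof.
have F_diff := differentiable_avg f_diff.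
have F_lip := lipschitz_grad_avg f_diff (ltW L_gt0) f_lip.
have Gs0 := grad_min F_diff F_lip L_gt0 xs_opt.
rewrite -grad_avg// /noise Gs0 subr0.
have hmu := strongly_monotone F_sconvex x xs.
have hco := cocoercive (f_diff i) (f_lip i) (f_convex i) L_gt0 x xs.
have hl := lipschitz_grad_sqr (f_lip i) (ltW L_gt0) y xs.
have hG := lipschitz_grad_sqr F_lip (ltW L_gt0) y xs.
rewrite Gs0 !subr0 in hmu hG.
move: hmu hco hl hG; rewrite /sqdist addrAC.
move: (dotv (y - xs) (y - xs)) (x - xs) => D e.
move: (grad (f i) x) (grad (f i) y) (grad (f i) xs).
move: (grad (avg f) x) (grad (avg f) y).
move=> gx gy a c b hmu hco hl hG.
(* The 8 is [4 + 4]: splitting the second part again leaves [4 |c - b|^2 + 4 |gy|^2], and each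
   square is at most [L^2 D]. *)
have hv : dotv (a - c + gy) (a - c + gy)
    <= 2 * L * dotv (a - b) e + 8 * L ^+ 2 * D.
  have -> : a - c + gy = (a - b) - ((c - b) - gy).
    by apply/rowP => j; rewrite !mxE; ring.
  have := dotv_sqrB_le (a - b) ((c - b) - gy).
  have := dotv_sqrB_le (c - b) gy.
  lra.
have := ler_wpM2l (sqr_ge0 eta) hv.
(* The coefficient joins [2 eta] from the cross term with [2 eta^2 L] from [hv]; [eta * L < 1] gives
   it the sign that strong monotonicity requires. *)
have : 2 * eta * (1 - eta * L) * (mu * dotv e e) <=
       2 * eta * (1 - eta * L) * dotv gx e.
  by apply: ler_wpM2l => //; rewrite !mulr_ge0 ?subr_ge0 ?ltW.
have -> : dotv (e - eta *: (a - c + gy)) (e - eta *: (a - c + gy)) =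
    dotv e e - 2 * eta * dotv (a - c + gy) e
    + eta ^+ 2 * dotv (a - c + gy) (a - c + gy).
  move: (a - c + gy) => v; rewrite !dotvE (dotvC e v); ring.
move: (dotv (a - c + gy) (a - c + gy)) => V.
rewrite /rho /drift !(dotvDl, dotvNl).
lra.
Qed.

End contraction.

(** * Dependence of the iterates on earlier draws *)

Section iterates.
Variables (R : realType) (d n : nat) (f : 'I_n -> 'rV[R]_d -> R).
Variables (m : nat) (eta : R).

Lemma eq_svrg_inner x (g h : nat -> 'I_n) t :
  (forall r, (r < t)%N -> g r = h r) ->
  svrg_inner f eta x g t = svrg_inner f eta x h t.
Proof.
elim: t => [//|t IH] gh; rewrite /= (IH (fun r rt => gh r (ltnW rt))).
by rewrite (gh t (ltnSn t)).
Qed.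

(** Makes the start of epoch [k] adapted to the first [k * m] draws, and lets the infinite sequence
    of draws be truncated. *)
Lemma eq_svrgI x0 (g h : nat -> 'I_n) k :
  (forall r, (r < k * m)%N -> g r = h r) ->
  svrgI f m eta x0 g k = svrgI f m eta x0 h k.
Proof.
elim: k => [//|k IH] gh /=.
rewrite IH => [|r rk]; last by apply: gh; rewrite mulSn ltn_addl.
by apply: eq_svrg_inner => r rm; apply: gh; rewrite mulSn addnC ltn_add2r.
Qed.

End iterates.

(** * Expectations over finitely many outcomes *)

Section finite_sampling.
Variables (R : realType) (d n : nat) (f : 'I_n -> 'rV[R]_d -> R).
Variables (Omega : finType) (p : Omega -> R) (ix : nat -> Omega -> 'I_n).
Variable N : nat.

(** The classes of this equivalence are the atoms generated by the first [s] draws. *)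
Definition same_past s (w w' : Omega) : bool :=
  [forall r : 'I_s, ix r w == ix r w'].

Lemma same_pastP s w w' :
  reflect (forall r, (r < s)%N -> ix r w = ix r w') (same_past s w w').
Proof.
apply: (iffP forallP) => [h r rs|h r]; last exact/eqP/h.
exact: eqP (h (Ordinal rs)).
Qed.

(** Measurability with respect to the first [s] draws, encoded as constancy on these atoms. *)
Definition adapted (A : Type) s (x : Omega -> A) : Prop :=
  forall w w', same_past s w w' -> x w = x w'.

Hypothesis unbiased_fin : forall s w0 x j, (s < N)%N ->
  \sum_(w | same_past s w w0) p w * noise f (ix s w) x 0 j = 0.

(** On each class of [same_past s] the maps [x] and [a] are constant, so unbiasedness at a fixed
    point applies class by class and the coordinates of [a] factor out. *)
Lemma expectation_noise s (x a : Omega -> 'rV[R]_d) : (s < N)%N ->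
  adapted s x -> adapted s a ->
  \sum_w p w * dotv (noise f (ix s w) (x w)) (a w) = 0.
Proof.
move=> sN x_ad a_ad.
pose hist w : {ffun 'I_s -> 'I_n} := [ffun r : 'I_s => ix r w].
have histP w w0 : (hist w == hist w0) = same_past s w w0.
  apply/eqP/forallP => [/ffunP h r|h].
    by have := h r; rewrite !ffunE => ->.
  by apply/ffunP => r; rewrite !ffunE; exact/eqP.
rewrite (partition_big hist predT)//=; apply: big1 => h _.
(* A history attained by no outcome contributes an empty sum. *)
have [w0 /eqP <-|h0] := pickP (fun w => hist w == h); last first.
  by rewrite big_pred0.
under eq_bigl do rewrite histP.
transitivity (\sum_(w | same_past s w w0)
    \sum_j a w0 0 j * (p w * noise f (ix s w) (x w0) 0 j)).
  apply: eq_bigr => w ww0; rewrite (x_ad _ _ ww0) (a_ad _ _ ww0) mulr_sumr.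
  by apply: eq_bigr => j _; rewrite [in LHS]mulrA mulrC.
rewrite exchange_big big1//= => j _.
by rewrite -mulr_sumr unbiased_fin// mulr0.
Qed.

Variables (L mu eta : R).
Hypothesis f_convex : forall i, convex_function [set: 'rV[R]_d] (f i).
Hypothesis f_diff : forall i x, differentiable (f i) x.
Hypothesis f_lip : forall i, lipschitz_grad L (f i).
Hypothesis L_gt0 : 0 < L.
Hypothesis mu_gt0 : 0 < mu.
Hypothesis mu_le_L : mu <= L.
Hypothesis F_sconvex : strongly_convex mu (avg f).
Variable xs : 'rV[R]_d.
Hypothesis xs_opt : forall x, avg f xs <= avg f x.
Hypothesis eta_gt0 : 0 < eta.
Hypothesis etaL_lt1 : eta * L < 1.
Hypothesis p_ge0 : forall w, 0 <= p w.

Let sqdist (x : 'rV[R]_d) : R := dotv (x - xs) (x - xs).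
Let rho : R := 1 - 2 * eta * mu * (1 - eta * L).
Let beta : R := 4 * eta * L ^+ 2 / (mu * (1 - eta * L)).
Let E (X : Omega -> R) : R := \sum_w p w * X w.

(** With [q = eta * L], [mu <= L] gives [1 - rho <= 2 q (1 - q) <= 1 / 2]. *)
Lemma rho_gt0 : 0 < rho.
Proof.
have etaL0 : 0 < eta * L by rewrite mulr_gt0.
have : eta * mu * (1 - eta * L) <= eta * L * (1 - eta * L).
  by apply: ler_wpM2r; rewrite ?subr_ge0 ?(ltW etaL_lt1)// ler_pM2l.
rewrite /rho; have := sqr_ge0 (2 * (eta * L) - 1); nra.
Qed.

Lemma rho_lt1 : rho < 1.
Proof. by rewrite ltrBlDr ltrDl !mulr_gt0 ?subr_gt0. Qed.

Lemma beta_gt0 : 0 < beta.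
Proof. by rewrite divr_gt0 ?mulr_gt0 ?exprn_gt0 ?subr_gt0. Qed.

(* One step gives [E_(t+1) <= rho E_t + (1 - rho) beta E_0]; the stated factor
   solves this recursion and falls short of the rate by [rho ^ t * beta], which
   is what makes the final inequality strict. *)
Lemma inner_expectation_le s t (y : Omega -> 'rV[R]_d) :
  (s + t <= N)%N -> adapted s y ->
  E (fun w => sqdist (svrg_inner f eta (y w) (fun r => ix (s + r) w) t))
    <= (rho ^+ t + (1 - rho ^+ t) * beta) * E (fun w => sqdist (y w)).
Proof.
move=> stN ys.
pose z t w := svrg_inner f eta (y w) (fun r => ix (s + r) w) t.
have ad_le (A : Type) s1 s2 (x : Omega -> A) : (s1 <= s2)%N ->
    adapted s1 x -> adapted s2 x.
  move=> s12 xs1 w w' /same_pastP ww'; apply: xs1; apply/same_pastP => r rs.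
  exact/ww'/(leq_trans rs).
have z_ad u : adapted (s + u) (z u).
  elim: u => [|u IH] w w' ww'; first by apply: ys; rewrite -[s]addn0.
  rewrite /z /= -!/(z u _).
  have -> : y w = y w' by apply: (ad_le _ _ _ _ _ ys) ww'; rewrite leq_addr.
  have -> : z u w = z u w' by apply: (ad_le _ _ _ _ _ IH) ww'; rewrite addnS.
  by rewrite (same_pastP _ _ _ ww')// addnS.
have e_ad u : adapted (s + u) (fun w => z u w - xs).
  by move=> w w' ww'; rewrite (z_ad u _ _ ww').
have y_ad u : adapted (s + u) y by exact/(ad_le _ _ _ _ _ ys)/leq_addr.
have step u : (s + u < N)%N -> E (fun w => sqdist (z u.+1 w)) <=
    rho * E (fun w => sqdist (z u w))
    + 8 * eta ^+ 2 * L ^+ 2 * E (fun w => sqdist (y w)).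
  move=> suN; have n1 := expectation_noise suN (z_ad u) (e_ad u).
  have n2 := expectation_noise suN (y_ad u) (e_ad u).
  have n3 := expectation_noise suN
    ((fun _ _ _ => erefl) : adapted (s + u) (fun=> xs)) (e_ad u).
  (* With the noise terms kept, the bound holds outcome by outcome; they vanish only after
     summation. *)
  suff : E (fun w => sqdist (z u.+1 w)) <= rho * E (fun w => sqdist (z u w))
      + 8 * eta ^+ 2 * L ^+ 2 * E (fun w => sqdist (y w))
      + (2 * eta ^+ 2 * L - 2 * eta)
        * E (fun w => dotv (noise f (ix (s + u) w) (z u w)) (z u w - xs))
      + 2 * eta * E (fun w => dotv (noise f (ix (s + u) w) (y w)) (z u w - xs))
      - 2 * eta ^+ 2 * L
        * E (fun w => dotv (noise f (ix (s + u) w) xs) (z u w - xs)).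
    by rewrite /E n1 n2 n3 !mulr0 !addr0 subr0.
  rewrite /E !mulr_sumr -!big_split -sumrB /=; apply: ler_sum => w _.
  apply: le_trans (ler_wpM2l (p_ge0 w) (svrg_step_le f_convex f_diff f_lip
    L_gt0 F_sconvex xs_opt eta_gt0 etaL_lt1 (ix (s + u) w) (z u w) (y w))) _.
  rewrite -/(sqdist _) -/(sqdist _) -/rho le_eqVlt.
  by apply/orP/or_introl/eqP; ring.
rewrite -/(z t); elim: t stN => [|t IH] stN.
  by rewrite expr0 subrr mul0r addr0 mul1r.
rewrite addnS in stN.
apply: le_trans (step t stN) _.
have := ler_wpM2l (ltW rho_gt0) (IH (ltnW stN)).
(* So [beta] is the fixed point of the recursion normalized by [E_0 = 1]. *)
have -> : 8 * eta ^+ 2 * L ^+ 2 = (1 - rho) * beta.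
  by rewrite /rho /beta; field; rewrite !gt_eqF// subr_gt0.
rewrite exprS; lra.
Qed.

(** Epoch [k] starts from a point adapted to the first [k * m] draws, so [inner_expectation_le]
    applies with [s = k * m] and contributes one factor [gam]. *)
Lemma svrgI_expectation_le m x0 k : (k * m <= N)%N -> \sum_w p w = 1 ->
  E (fun w => sqdist (svrgI f m eta x0 (fun s => ix s w) k))
    <= (rho ^+ m + (1 - rho ^+ m) * beta) ^+ k * sqdist x0.
Proof.
move=> kmN p1; set gam := _ + _.
have gam_ge0 : 0 <= gam.
  rewrite addr_ge0 ?exprn_ge0 ?(ltW rho_gt0)// mulr_ge0 ?(ltW beta_gt0)//.
  by rewrite subr_ge0 exprn_ile1 ?ltW ?rho_gt0 ?rho_lt1.
pose z k w := svrgI f m eta x0 (fun s => ix s w) k.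
have z_ad j : adapted (j * m) (z j).
  by move=> w w' /same_pastP ww'; exact: eq_svrgI.
rewrite -/(z k); elim: k kmN => [|k IH] kmN.
  by rewrite expr0 mul1r /E /= -mulr_suml p1 mul1r.
rewrite mulSn addnC in kmN.
apply: le_trans (inner_expectation_le kmN (z_ad k)) _.
rewrite -/rho -/beta -/gam exprS -mulrA ler_wpM2l// IH//.
exact: leq_trans (leq_addr _ _) kmN.
Qed.

End finite_sampling.

(** * Passage from the probability space to finite histories *)

Lemma expectation_comp_fin (R : realType) (disp : measure_display)
    (T : measurableType disp) (P : probability T R) (Omega : finType)
    (H : T -> Omega) (G : Omega -> R) :
  (forall o, measurable [set w | H w = o]) ->
  ('E_P[fun w => G (H w)]
   = (\sum_o fine (P [set w | H w = o]) * G o)%R%:E)%E.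
Proof.
move=> mH; rewrite unlock.
(* The composite is a finite combination of indicators of the level sets of [H]. *)
have -> : (fun w => (G (H w))%:E) =
    (fun w => \sum_o (G o)%:E * (\1_[set w | H w = o] w)%:E)%E.
  apply/funext => w; rewrite (bigD1 (H w))//= big1 ?adde0 => [|o oH].
    by rewrite indicE mem_set// mule1.
  by rewrite indicE memNset ?mule0//= => Ho; rewrite Ho eqxx in oH.
rewrite integral_sum//; last first.
  by move=> o; apply: integrableZl => //; exact: integrable_indic.
rewrite -sumEFin; apply: eq_bigr => o _.
rewrite integralZl//; last exact: integrable_indic.
rewrite integral_indic// setIT EFinM fineK ?fin_num_measure//.
by rewrite muleC.
Qed.

Section history.
Variables (R : realType) (d n : nat) (f : 'I_n -> 'rV[R]_d -> R).
Variables (disp : measure_display) (T : measurableType disp).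
Variables (P : probability T R) (idx : nat -> T -> 'I_n).
Hypothesis idx_meas : random_indices idx.
Variable N : nat.

Let Omega := {ffun 'I_N.+1 -> 'I_n}.

Definition history (w : T) : Omega := [ffun r : 'I_N.+1 => idx r w].

(** [inord] requires the successor in [Omega]; beyond [N] it falls back to position 0, hence the
    bound in [draw_history]. *)
Definition draw (s : nat) (o : Omega) : 'I_n := o (inord s).

Definition history_prob (o : Omega) : R := fine (P [set w | history w = o]).

Lemma draw_history s w : (s <= N)%N -> draw s (history w) = idx s w.
Proof. by move=> sN; rewrite /draw ffunE inordK. Qed.

Lemma measurable_history o : measurable [set w | history w = o].
Proof.
have -> : [set w | history w = o] =
    \big[setI/setT]_(r < N.+1) [set w | idx r w = o r].
  apply/seteqP; split => [w <-|w] /=.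
    by rewrite -bigcap_seq => r _ /=; rewrite ffunE.
  rewrite -bigcap_seq => h; apply/ffunP => r; rewrite ffunE.
  by apply: h; rewrite /= mem_index_enum.
by apply: bigsetI_measurable => r _; exact: idx_meas.
Qed.

Lemma expectation_history (G : Omega -> R) :
  ('E_P[fun w => G (history w)] = (\sum_o history_prob o * G o)%R%:E)%E.
Proof. exact/expectation_comp_fin/measurable_history. Qed.

Lemma history_prob_ge0 o : 0 <= history_prob o.
Proof. exact/fine_ge0/measure_ge0. Qed.

Lemma sum_history_prob : \sum_o history_prob o = 1.
Proof.
have := expectation_history (fun=> 1); rewrite expectation_cst => -[->].
by apply: eq_bigr => o _; rewrite mulr1.
Qed.

(** The class of [o0] corresponds to the event [past] prescribed by the draws of [o0], so [unbiased]
    turns into an identity of finite sums over histories. *)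
Lemma unbiased_history s o0 x j : unbiased P idx f -> (s < N)%N ->
  \sum_(o | same_past draw s o o0) history_prob o * noise f (draw s o) x 0 j
    = 0.
Proof.
move=> unb sN.
have pastE w : \1_(past idx s (draw^~ o0)) w =
    (same_past draw s (history w) o0)%:R :> R.
  rewrite indicE; congr (_%:R); congr nat_of_bool.
  apply/idP/same_pastP => [|h].
    rewrite inE => h r rs; rewrite draw_history ?h//.
    exact/ltnW/(ltn_trans rs).
  rewrite inE => r rs; rewrite -h// draw_history//.
  exact/ltnW/(ltn_trans rs).
have mpast : measurable (past idx s (draw^~ o0)).
  have -> : past idx s (draw^~ o0) =
      \big[setI/setT]_(r < s) [set w | idx r w = draw r o0].
    apply/seteqP; split => [w h|w] /=.
      by rewrite -bigcap_seq => r _ /=; exact: h.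
    rewrite -bigcap_seq => h r rs.
    by apply: (h (Ordinal rs)); rewrite /= mem_index_enum.
  by apply: bigsetI_measurable => r _; exact: idx_meas.
have Ppast : P (past idx s (draw^~ o0)) =
    (\sum_(o | same_past draw s o o0) history_prob o)%:E.
  rewrite -expectation_indic//.
  transitivity ('E_P[fun w => (same_past draw s (history w) o0)%:R])%E.
    by congr ('E_P[_])%E; apply/funext => w; rewrite pastE.
  rewrite (expectation_history (fun o => (same_past draw s o o0)%:R)).
  congr EFin; rewrite [RHS]big_mkcond; apply: eq_bigr => o _.
  by case: ifP => _; rewrite ?mulr1 ?mulr0.
have := unb s (draw^~ o0) x j; rewrite Ppast -EFinM.
pose G o := grad (f (draw s o)) x 0 j * (same_past draw s o o0)%:R.
have -> : (fun w => grad (f (idx s w)) x 0 j * \1_(past idx s (draw^~ o0)) w) =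
    (fun w => G (history w)).
  by apply/funext => w; rewrite /G pastE draw_history// ltnW.
rewrite (expectation_history G) => -[] h.
have E : \sum_(o | same_past draw s o o0)
      history_prob o * grad (f (draw s o)) x 0 j =
    grad (avg f) x 0 j * \sum_(o | same_past draw s o o0) history_prob o.
  rewrite -h [LHS]big_mkcond; apply: eq_bigr => o _; rewrite /G.
  by case: ifP => _; rewrite ?mulr1 ?mulr0.
under eq_bigr do rewrite mxE [X in _ * (_ + X)]mxE mulrBr.
rewrite sumrB E mulr_sumr; under [X in _ - X]eq_bigr do rewrite mulrC.
by rewrite subrr.
Qed.

End history.

Theorem corollary3p6 (R : realType) (d n : nat)
    (f : 'I_n -> 'rV[R]_d -> R) (L mu : R)
    (f_convex : forall i, convex_function [set: 'rV[R]_d] (f i))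
    (f_diff : forall i x, differentiable (f i) x)
    (f_lip : forall i, lipschitz_grad L (f i))
    (mu_gt0 : 0 < mu)
    (F_sconvex : strongly_convex mu (avg f))
    (xstar : 'rV[R]_d) (xstar_opt : forall x, avg f xstar <= avg f x)
    (disp : measure_display) (T : measurableType disp) (P : probability T R)
    (idx : nat -> T -> 'I_n)
    (idx_meas : random_indices idx)
    (idx_unbiased : unbiased P idx f)
    (m : nat) (eta : R) (eta_gt0 : 0 < eta) (etaL_lt1 : eta * L < 1)
    (rate_lt1 : svrg_rate mu L eta m < 1)
    (x0 : 'rV[R]_d) (x0_neq : x0 <> xstar)
    (k : nat) (k_gt0 : (0 < k)%N) :
  ('E_P[fun w => (norm2 (svrgI f m eta x0 (fun s => idx s w) k - xstar) ^+ 2)%R]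
   < (svrg_rate mu L eta m ^+ k * norm2 (x0 - xstar) ^+ 2)%:E)%E.
Proof.
have D0 : 0 < dotv (x0 - xstar) (x0 - xstar).
  rewrite lt_neqAle dotvv_ge0 andbT eq_sym; apply/eqP => /dotvv_eq0 /eqP.
  by rewrite subr_eq0 => /eqP.
(* Total mass 1 forces an outcome; its first draw names a component, whose Lipschitz bound at
   [x0 <> xstar] gives [0 <= L]. *)
have [w0] : exists w : T, True.
  apply: contrapT => T0; have := @probability_setT _ _ _ P.
  suff -> : [set: T] = set0 by rewrite measure0 => /esym/eqP; rewrite onee_eq0.
  by apply/seteqP; split => // w _; apply: T0; exists w.
move=> _; have L_ge0 : 0 <= L.
  have := le_trans (norm2_ge0 _) (f_lip (idx 0%N w0) x0 xstar).
  by rewrite pmulr_lge0 // sqrtr_gt0.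
have F_lip := lipschitz_grad_avg f_diff L_ge0 f_lip.
have mu_le_L := strong_convexity_le_lipschitz F_lip F_sconvex L_ge0 x0_neq.
have L_gt0 := lt_le_trans mu_gt0 mu_le_L.
pose N := (k * m)%N.
pose G (o : {ffun 'I_N.+1 -> 'I_n}) :=
  norm2 (svrgI f m eta x0 (fun s => draw s o) k - xstar) ^+ 2.
have -> : (fun w => norm2 (svrgI f m eta x0 (fun s => idx s w) k - xstar) ^+ 2)
    = (fun w => G (history idx N w)).
  apply/funext => w; congr (norm2 (_ - _) ^+ 2); apply: eq_svrgI => r rN.
  by rewrite draw_history// ltnW.
rewrite (expectation_history P idx_meas G) lte_fin.
under eq_bigr do rewrite /G norm2_sqr.
rewrite norm2_sqr.
have unb s o0 x j := @unbiased_history _ _ _ f _ _ P _ idx_meas N s o0 x j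
  idx_unbiased.
have := svrgI_expectation_le unb f_convex f_diff f_lip L_gt0 mu_gt0 mu_le_L
  F_sconvex xstar_opt eta_gt0 etaL_lt1 (history_prob_ge0 P idx (N := N))
  x0 (leqnn N) (sum_history_prob P idx_meas N).
move/le_lt_trans; apply; rewrite ltr_pM2r//.
have r0 := rho_gt0 L_gt0 mu_le_L eta_gt0 etaL_lt1.
have r1 := rho_lt1 mu_gt0 eta_gt0 etaL_lt1.
have b0 := beta_gt0 L_gt0 mu_gt0 eta_gt0 etaL_lt1.
have rm0 := exprn_gt0 m r0.
have rm1 := exprn_ile1 m (ltW r0) (ltW r1).
rewrite /svrg_rate; move: rm0 rm1 b0.
set r := (_ ^+ m); set b := _ / _ => rm0 rm1 b0.
(* Strictness comes from [r * b > 0], and [k > 0] preserves it under the power. *)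
have gap : r + (1 - r) * b < r + b.
  by rewrite ltrD2l mulrBl mul1r ltrBlDr ltrDl mulr_gt0.
by rewrite ltrXn2r -?lt0n// addr_ge0 ?(ltW rm0)// mulr_ge0 ?(ltW b0) ?subr_ge0.
Qed.
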